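(* Let $V:\Omega\to[1,\infty)$ be measurable and let $(S_t)_{t\ge0}$ be a stochastic semigroup on $\mathcal M_V$. Assume: (1) (semigroup Lyapunov condition) there exist $\sigma,b>0$ such that $$\|S_t\mu\|_V\le e^{-\sigma t}\|\mu\|_V+\frac b\sigma(1-e^{-\sigma t})\|\mu\|\qquad\text{for all }t\ge0,\ \mu\in\mathcal M_V;$$ (2) for some $T>0$ there exist $0<\gamma_H<1$ and $A>0$ with $b/A<\sigma$ such that for every $\nu\in\mathcal N_V$ with $\|\nu\|_V\le A\|\nu\|$ one has $\|S_T\nu\|\le\gamma_H\|\nu\|$. Then the semigroup has an invariant probability measure $\mu^*\in\mathcal P_V$ (i.e. $S_t\mu^*=\mu^*$ for all $t\ge0$), unique within $\mathcal P_V$, and there exist $\lambda,C>0$ such that $\|S_t\nu\|_V\le Ce^{-\lambda t}\|\nu\|_V$ for all $t\ge0$ and all $\nu\in\mathcal N_V$.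
   Context: Let $(\Omega,\mathcal E)$ be a measurable space. $\mathcal M$ denotes the space of finite signed measures on $\Omega$, $\mathcal P\subset\mathcal M$ the set of probability measures, and $\mathcal N=\{\nu\in\mathcal M:\nu(\Omega)=0\}$. For $\mu\in\mathcal M$ with Hahn–Jordan decomposition $\mu=\mu_+-\mu_-$, $|\mu|=\mu_++\mu_-$ and $\|\mu\|=\int_\Omega d|\mu|$ is the total variation norm. For a measurable $W:\Omega\to[1,\infty)$, $\|\mu\|_W=\int_\Omega W\,d|\mu|$, $\mathcal M_W=\{\mu\in\mathcal M:\|\mu\|_W<\infty\}$, $\mathcal P_W=\mathcal P\cap\mathcal M_W$, $\mathcal N_W=\mathcal N\cap\mathcal M_W$. A stochastic operator is a linear map $S:\mathcal M\to\mathcal M$ with $S(\mathcal P)\subseteq\mathcal P$. A stochastic semigroup is a family $(S_t)_{t\ge0}$ of stochastic operators with $S_0=I$ and $S_tS_s=S_{t+s}$ for all $s,t\ge0$; it is a stochastic semigroup on $\mathcal M_W$ if moreover each $S_t$ maps $\mathcal M_W$ into itself and there exist $C_W\ge1$, $\omega_W\ge0$ with $\|S_t\mu\|_W\le C_We^{\omega_Wt}\|\mu\|_W$ for all $\mu\in\mathcal M_W$, $t\ge0$. *)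

(* Defs.v *)
(* Finite signed measures are the
   library's charges {charge set T -> \bar R}. *)
From HB Require Import structures.
From mathcomp Require Import all_boot all_order all_algebra.
From mathcomp Require Import all_classical all_reals all_analysis.

Set Implicit Arguments.
Unset Strict Implicit.
Unset Printing Implicit Defensive.

Import Order.TTheory GRing.Theory Num.Theory.
Import numFieldNormedType.Exports.
Local Open Scope classical_set_scope.
Local Open Scope ring_scope.
Local Open Scope ereal_scope.

Section signed_measures.
Context d (T : measurableType d) (R : realType).

Definition hahnP (nu : {charge set T -> \bar R}) : set T :=
  projT1 (cid (Hahn_decomposition nu)).
Definition hahnN (nu : {charge set T -> \bar R}) : set T :=
  projT1 (cid (projT2 (cid (Hahn_decomposition nu)))).
Definition hahn_spec (nu : {charge set T -> \bar R}) :
  hahn_decomposition nu (hahnP nu) (hahnN nu) :=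
  projT2 (cid (projT2 (cid (Hahn_decomposition nu)))).

(* |nu| = nu_+ + nu_- (Hahn-Jordan); charge_variation is that measure. *)
Definition wnorm (W : T -> R) (nu : {charge set T -> \bar R}) : \bar R :=
  \int[charge_variation (hahn_spec nu)]_x (W x)%:E.

Definition tvnorm (nu : {charge set T -> \bar R}) : \bar R :=
  charge_variation (hahn_spec nu) [set: T].

Definition inMW (W : T -> R) (nu : {charge set T -> \bar R}) : Prop :=
  wnorm W nu < +oo.

Definition inN (nu : {charge set T -> \bar R}) : Prop := nu [set: T] = 0.

Definition inP (nu : {charge set T -> \bar R}) : Prop :=
  (forall A, measurable A -> 0 <= nu A) /\ nu [set: T] = 1.

Definition ceq (mu nu : {charge set T -> \bar R}) : Prop :=
  forall A, measurable A -> mu A = nu A.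

Definition stochastic_operator
    (S : {charge set T -> \bar R} -> {charge set T -> \bar R}) : Prop :=
  (forall (a b : R) (mu nu : {charge set T -> \bar R}),
     ceq (S (cadd (cscale a mu) (cscale b nu)))
         (cadd (cscale a (S mu)) (cscale b (S nu))))
  /\ (forall mu, inP mu -> inP (S mu)).

Definition stochastic_semigroup
    (S : R -> {charge set T -> \bar R} -> {charge set T -> \bar R}) : Prop :=
  [/\ forall t, (0 <= t)%R -> stochastic_operator (S t),
      forall mu, ceq (S 0%R mu) mu &
      forall s t mu, (0 <= s)%R -> (0 <= t)%R ->
        ceq (S (t + s)%R mu) (S t (S s mu))].

Definition stochastic_semigroup_on (W : T -> R)
    (S : R -> {charge set T -> \bar R} -> {charge set T -> \bar R}) : Prop :=
  [/\ stochastic_semigroup S,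
      forall t mu, (0 <= t)%R -> inMW W mu -> inMW W (S t mu) &
      exists (CW omegaW : R), (1 <= CW)%R /\ (0 <= omegaW)%R /\
        forall t mu, (0 <= t)%R -> inMW W mu ->
          wnorm W (S t mu) <= (CW * expR (omegaW * t))%:E * wnorm W mu].

End signed_measures.

(* Main.v *)
(* Write [|nu|] for the total variation norm and [e = exp (- sigma T)]. On the
   measures of mass zero, [N nu = |nu| + beta |nu|_V] is strictly contracted by
   [S_T] for small [beta]: when [|nu|_V <= A |nu|] the hypothesis on [S_T]
   shrinks the first term and [beta] absorbs the Lyapunov remainder; when
   [|nu|_V > A |nu|] the Lyapunov bound replaces [|nu|_V] by at most
   [(e + (1 - e) b / (sigma A)) |nu|_V], and [b / A < sigma]. Iterating [S_T]
   and using the Lyapunov bound between multiples of [T] gives the exponential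
   decay. Hence [S_n delta] is Cauchy in the complete weighted norm; its limit
   is the invariant measure, and decay of differences gives uniqueness. *)
Require Import Defs.
From HB Require Import structures.
From mathcomp Require Import all_boot all_order all_algebra.
From mathcomp Require Import all_classical all_reals all_analysis.
From mathcomp Require Import measurable_realfun.
From mathcomp Require Import ring lra.
Set Implicit Arguments.
Unset Strict Implicit.
Unset Printing Implicit Defensive.

Import Order.TTheory GRing.Theory Num.Theory.
Import numFieldNormedType.Exports.
Local Open Scope classical_set_scope.
Local Open Scope ring_scope.

(** * Total variation and weighted norms of charges *)

Section weighted_norm.
Context (d : measure_display) (T : measurableType d) (R : realType).
Implicit Types mu nu : {charge set T -> \bar R}.
Local Open Scope ereal_scope.

Local Notation variation nu := (charge_variation (hahn_spec nu)).

Definition clin (a b : R) mu nu : {charge set T -> \bar R} :=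
  cadd (cscale a mu) (cscale b nu).

(** Encoded as a linear combination, so that [wnorm_lin] and the linearity of a stochastic operator
    apply to differences directly. *)
Definition csub mu nu := clin 1 (-1) mu nu.

Lemma clinE a b mu nu A : clin a b mu nu A = a%:E * mu A + b%:E * nu A.
Proof. by []. Qed.

Lemma csubE mu nu A : csub mu nu A = mu A - nu A.
Proof. by rewrite clinE mul1e mulN1e. Qed.

(** Minimality of the variation: on the two Hahn pieces of [A] it is [nu] and [- nu], each at most
    [m], and additivity recombines the pieces. The norm bounds below come from exhibiting such a
    majorant. *)
Lemma variation_le (m : set T -> \bar R) nu : additive2 m ->
  (forall A, measurable A -> `|nu A| <= m A) ->
  forall A, measurable A -> variation nu A <= m A.
Proof.
move=> madd num A mA; have [[mP posP] [mN negN] PNT PN0] := hahn_spec nu.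
rewrite /charge_variation/= jordan_posE cjordan_posE jordan_negE cjordan_negE.
rewrite /crestr0 mem_set// /crestr.
have mAP : measurable (A `&` hahnP nu) by exact: measurableI.
have mAN : measurable (A `&` hahnN nu) by exact: measurableI.
have -> : m A = m (A `&` hahnP nu) + m (A `&` hahnN nu).
  rewrite -madd//; first by rewrite -setIUr PNT setIT.
  by rewrite setIACA PN0 setI0.
apply: leeD; first by rewrite (le_trans (lee_abs _))// num.
by rewrite (le_trans (lee_abs _))// abseN num.
Qed.

Section fixed_weight.
Variable W : T -> R.
Hypotheses (mW : measurable_fun setT W) (W0 : forall x, (0 <= W x)%R).

Let mEW : measurable_fun setT (fun x => (W x)%:E).
Proof. exact/measurable_EFinP. Qed.

Lemma wnorm_ge0 nu : 0 <= wnorm W nu.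
Proof. by apply: integral_ge0 => x _; rewrite lee_fin. Qed.

Lemma wnorm_le_integral (m : {measure set T -> \bar R}) nu :
  (forall A, measurable A -> `|nu A| <= m A) ->
  wnorm W nu <= \int[m]_x (W x)%:E.
Proof.
move=> num; apply: ge0_le_measure_integral => //.
by apply: variation_le => //; exact: measureU.
Qed.

Lemma wnorm_ceq mu nu : ceq mu nu -> wnorm W mu = wnorm W nu.
Proof.
move=> e; apply/eqP; rewrite eq_le; apply/andP; split;
  apply: wnorm_le_integral => A mA; [rewrite e//|rewrite -e//];
  exact: abse_charge_variation.
Qed.

Lemma wnorm_lin a b mu nu :
  wnorm W (clin a b mu nu) <=
  `|a|%R%:E * wnorm W mu + `|b|%R%:E * wnorm W nu.
Proof.
pose m := measure_add (mscale (NngNum (normr_ge0 a)) (variation mu))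
                      (mscale (NngNum (normr_ge0 b)) (variation nu)).
apply: (@le_trans _ _ (\int[m]_x (W x)%:E)).
  apply: wnorm_le_integral => A mA.
  rewrite [leRHS](measure_addE _ _ A) clinE.
  apply: le_trans (lee_abs_add _ _) _; rewrite !abseM !abse_EFin.
  by apply: leeD; apply: lee_pmul => //; exact: abse_charge_variation.
rewrite /m ge0_integral_measure_add//; last by move=> x _; rewrite lee_fin.
by rewrite !ge0_integral_mscale// => x _; rewrite lee_fin.
Qed.

Lemma wnorm_triangle mu nu : wnorm W mu <= wnorm W (csub mu nu) + wnorm W nu.
Proof.
have -> : wnorm W mu = wnorm W (clin 1 1 (csub mu nu) nu).
  apply: wnorm_ceq => A mA.
  by rewrite clinE !mul1e csubE subeK// fin_num_measure.
by apply: le_trans (wnorm_lin _ _ _ _) _; rewrite normr1 !mul1e.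
Qed.

Lemma wnorm_csub_triangle mu1 mu2 mu3 :
  wnorm W (csub mu1 mu3) <= wnorm W (csub mu1 mu2) + wnorm W (csub mu2 mu3).
Proof.
have -> : wnorm W (csub mu1 mu3) =
          wnorm W (clin 1 1 (csub mu1 mu2) (csub mu2 mu3)).
  apply: wnorm_ceq => A mA.
  by rewrite clinE !mul1e !csubE addeA subeK// fin_num_measure.
by apply: le_trans (wnorm_lin _ _ _ _) _; rewrite normr1 !mul1e.
Qed.

Lemma wnorm_csub mu nu : wnorm W (csub mu nu) <= wnorm W mu + wnorm W nu.
Proof.
by apply: le_trans (wnorm_lin _ _ _ _) _; rewrite normrN !normr1 !mul1e.
Qed.

Lemma wnorm_csubC mu nu : wnorm W (csub mu nu) = wnorm W (csub nu mu).
Proof.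
have H a b : wnorm W (csub a b) <= wnorm W (csub b a).
  apply: wnorm_le_integral => A mA.
  rewrite -abseN csubE fin_num_oppeB ?fin_num_measure// addeC -csubE.
  exact: abse_charge_variation.
by apply/eqP; rewrite eq_le !H.
Qed.

End fixed_weight.

Lemma tvnorm_wnorm nu : tvnorm nu = wnorm (cst 1%R) nu.
Proof. by rewrite /wnorm/= integral_cst// mul1e. Qed.

Lemma tvnorm_fin nu : tvnorm nu \is a fin_num.
Proof. exact: fin_num_measure. Qed.

Lemma abse_le_tvnorm nu A : measurable A -> `|nu A| <= tvnorm nu.
Proof.
move=> mA; apply: le_trans (abse_charge_variation (hahn_spec nu) mA) _.
by apply: le_measure; rewrite ?inE.
Qed.

Lemma tvnorm_ge0 nu : 0 <= tvnorm nu.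
Proof. exact: measure_ge0. Qed.

(** The majorant is a charge, not a measure, because images under a stochastic operator are only
    given as charges. *)
Lemma tvnorm_le_charge mu nu :
  (forall A, measurable A -> `|nu A| <= mu A) -> tvnorm nu <= mu setT.
Proof. by move=> numu; apply: variation_le => //; exact: chargeU. Qed.

Lemma ceq_tvnorm_csub mu nu : tvnorm (csub mu nu) <= 0 -> ceq mu nu.
Proof.
move=> z0 A mA.
have : csub mu nu A = 0.
  apply/eqP; rewrite -abse_eq0 eq_le abse_ge0 andbT.
  by rewrite (le_trans (abse_le_tvnorm _ mA)).
rewrite csubE => e.
by rewrite -(@subeK _ (mu A) (nu A)) ?fin_num_measure// e add0e.
Qed.

Lemma tvnorm_ceq mu nu : ceq mu nu -> tvnorm mu = tvnorm nu.
Proof. by move=> e; rewrite !tvnorm_wnorm; apply: wnorm_ceq e. Qed.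

Lemma tvnorm_csub_triangle mu1 mu2 mu3 :
  tvnorm (csub mu1 mu3) <= tvnorm (csub mu1 mu2) + tvnorm (csub mu2 mu3).
Proof. by rewrite !tvnorm_wnorm; apply: wnorm_csub_triangle. Qed.

Lemma tvnorm_csubC mu nu : tvnorm (csub mu nu) = tvnorm (csub nu mu).
Proof. by rewrite !tvnorm_wnorm; apply: wnorm_csubC. Qed.

Lemma tvnorm_le_wnorm (W : T -> R) nu : measurable_fun setT W ->
  (forall x, (1 <= W x)%R) -> tvnorm nu <= wnorm W nu.
Proof.
move=> mW W1; rewrite tvnorm_wnorm; apply: ge0_le_integral => //=.
- exact/measurable_EFinP.
- by move=> x _; rewrite lee_fin.
Qed.

End weighted_norm.

(** * Positivity, mass conservation and nonexpansiveness of stochastic operators *)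

Section stochastic.
Context (d : measure_display) (T : measurableType d) (R : realType).
Implicit Types mu nu : {charge set T -> \bar R}.
Local Open Scope ereal_scope.

(** A reference probability measure: it serves to normalize positive charges and, later, as the
    start of the orbit that converges to the invariant measure. *)
Definition cdirac : {charge set T -> \bar R} :=
  charge_of_finite_measure (\d_(point : T)).

Lemma inP_cdirac : inP cdirac.
Proof.
split; first by move=> A mA; exact: measure_ge0.
by rewrite [LHS]diracT.
Qed.

Lemma inP_le1 mu A : inP mu -> measurable A -> mu A <= 1.
Proof.
move=> [mu0 <-] mA; rewrite (chargeDI mu measurableT mA) setTI leeDr//.
by apply: mu0; exact: measurableD.
Qed.

Variable S : {charge set T -> \bar R} -> {charge set T -> \bar R}.
Hypothesis hS : stochastic_operator S.

Lemma stochastic_lin a b mu nu A : measurable A ->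
  S (clin a b mu nu) A = a%:E * S mu A + b%:E * S nu A.
Proof. by move=> mA; have [h _] := hS; rewrite (h a b mu nu A mA). Qed.

Lemma stochastic_csub mu nu : ceq (S (csub mu nu)) (csub (S mu) (S nu)).
Proof. by move=> A mA; rewrite stochastic_lin// -clinE. Qed.

(* Mixing with a Dirac mass makes [k mu] normalizable for every [k >= 0], even when [mu] vanishes. *)
Lemma stochastic_pos mu : (forall A, measurable A -> 0 <= mu A) ->
  (forall A, measurable A -> 0 <= S mu A) /\ S mu setT = mu setT.
Proof.
move=> mu0; have [_ SP] := hS.
have [m m0 Em] : exists2 m : R, (0 <= m)%R & mu setT = m%:E.
  exists (fine (mu setT)); first by rewrite fine_ge0// mu0.
  by rewrite fineK// fin_num_measure.
pose q (k : R) := clin (k / (k * m + 1)) (k * m + 1)^-1 mu cdirac.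
have [d0 d1] := inP_cdirac.
have qP k : (0 <= k)%R -> inP (q k).
  move=> k0; have km : (0 < k * m + 1)%R by rewrite ltr_wpDl// mulr_ge0.
  split.
    move=> A mA; rewrite clinE adde_ge0// mule_ge0 ?mu0 ?d0// lee_fin.
      by rewrite divr_ge0// ltW.
    by rewrite invr_ge0 ltW.
  rewrite clinE Em d1 -EFinM mule1 -EFinD; congr EFin.
  by field; rewrite gt_eqF.
split.
  move=> A mA; rewrite leNgt; apply/negP => neg.
  have finS nu : S nu A \is a fin_num by rewrite fin_num_measure.
  have y1 := inP_le1 (SP _ inP_cdirac) mA.
  move: neg y1; rewrite -(fineK (finS mu)) -(fineK (finS cdirac)).
  set x := fine _; set y := fine _; rewrite lte_fin lee_fin => xn y1.
  (* Chosen so that [k * x = - 2]. Since [y <= 1], the image of [q k] would be negative on [A],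
     although [q k] is a probability measure. *)
  pose k := (- 2 / x)%R.
  have k0 : (0 <= k)%R by rewrite /k mulr_le0 ?oppr_le0 ?invr_le0 ?ltW.
  have [/(_ A mA) + _] := SP _ (qP k k0).
  rewrite stochastic_lin// -(fineK (finS mu)) -(fineK (finS cdirac)) -/x -/y.
  have km : (0 < k * m + 1)%R by rewrite ltr_wpDl// mulr_ge0.
  rewrite -!EFinM -EFinD lee_fin.
  rewrite (_ : (k / _ * x + _)%R = ((k * m + 1)^-1 * (k * x + y))%R); last by ring.
  rewrite pmulr_rge0 ?invr_gt0//.
  have -> : (k * x = - 2)%R by rewrite /k mulfVK// lt_eqF.
  by move=> ?; lra.
(* For the mass, [k = 1] suffices: [S (q 1)] and [S cdirac] both have mass 1, which leaves one
   linear equation for the mass of [S mu]. *)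
have [_] := SP _ (qP 1%R ler01).
rewrite stochastic_lin//; have [_ ->] := SP _ inP_cdirac.
rewrite -(@fineK _ (S mu setT)) ?fin_num_measure// -!EFinM -EFinD Em.
set x := fine _ => -[]; rewrite !mul1r mulr1 => E; congr EFin.
have m1 : (m + 1 != 0)%R by rewrite gt_eqF// ltr_wpDl.
have : ((m + 1) * ((m + 1)^-1 * x + (m + 1)^-1) = m + 1)%R by rewrite E mulr1.
by rewrite mulrDr mulrA divff// mul1r => /addIr.
Qed.

(** Compatibility of [S] with setwise equality is not part of its definition. It follows from
    positivity: the difference of setwise equal charges is nonnegative in both orders, hence so is
    its image. *)
Lemma stochastic_ceq mu nu : ceq mu nu -> ceq (S mu) (S nu).
Proof.
have H a b : ceq a b -> forall A, measurable A -> S b A <= S a A.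
  move=> e A mA.
  have [|+ _] := @stochastic_pos (csub a b).
    by move=> B mB; rewrite csubE e// subee// fin_num_measure.
  move=> /(_ A mA); rewrite stochastic_csub// csubE sube_ge0//.
  by rewrite fin_num_measure.
move=> e A mA; apply/eqP; rewrite eq_le !H//.
by move=> B mB; rewrite e.
Qed.

Definition cpos mu : {charge set T -> \bar R} := jordan_pos (hahn_spec mu).
Definition cneg mu : {charge set T -> \bar R} := jordan_neg (hahn_spec mu).

Lemma ceq_jordan mu : ceq mu (csub (cpos mu) (cneg mu)).
Proof.
move=> A mA; rewrite (jordan_decomp (hahn_spec mu) mA) csubE.
by rewrite /cadd/= /cscale mulN1e.
Qed.

Lemma cpos_ge0 mu A : 0 <= cpos mu A. Proof. exact: measure_ge0. Qed.
Lemma cneg_ge0 mu A : 0 <= cneg mu A. Proof. exact: measure_ge0. Qed.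

Lemma stochastic_mass mu : S mu setT = mu setT.
Proof.
rewrite (stochastic_ceq (ceq_jordan mu))// stochastic_csub// csubE.
rewrite (ceq_jordan mu measurableT) csubE.
have [_ ->] := stochastic_pos (fun A _ => cpos_ge0 mu A).
by have [_ ->] := stochastic_pos (fun A _ => cneg_ge0 mu A).
Qed.

(** The images of the two Jordan parts are nonnegative, so their sum dominates [S mu] setwise; its
    total mass is that of the parts, namely the norm of [mu]. *)
Lemma tvnorm_stochastic mu : tvnorm (S mu) <= tvnorm mu.
Proof.
have [p0 pT] := stochastic_pos (fun A _ => cpos_ge0 mu A).
have [n0 nT] := stochastic_pos (fun A _ => cneg_ge0 mu A).
apply: le_trans (tvnorm_le_charge (mu := clin 1 1 (S (cpos mu)) (S (cneg mu))) _) _.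
  move=> A mA; rewrite (stochastic_ceq (ceq_jordan mu))// stochastic_csub//.
  rewrite csubE clinE !mul1e.
  by rewrite (le_trans (lee_abs_sub _ _))// !gee0_abs ?p0 ?n0.
by rewrite clinE !mul1e pT nT.
Qed.

End stochastic.

(** * Completeness of the weighted norm *)

Section completeness.
Context (d : measure_display) (T : measurableType d) (R : realType).
Local Open Scope ereal_scope.
Variable W : T -> R.
Hypotheses (mW : measurable_fun setT W) (W1 : forall x, (1 <= W x)%R).

Let W0 x : (0 <= W x)%R. Proof. exact: le_trans (W1 x). Qed.

Lemma mseries_split (m : {measure set T -> \bar R}^nat) n A :
  mseries m 0 A = \sum_(0 <= k < n) m k A + mseries m n A.
Proof. by rewrite /mseries (nneseries_split 0 n). Qed.

Lemma mseries_charge (m : {measure set T -> \bar R}^nat) :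
  mseries m 0 setT < +oo ->
  exists nu : {charge set T -> \bar R}, forall A, nu A = mseries m 0 A.
Proof.
move=> moo.
have fin : fin_num_fun (mseries m 0).
  move=> A mA; rewrite ge0_fin_numE ?measure_ge0//.
  by apply: le_lt_trans moo; apply: le_measure; rewrite ?inE.
pose C := isCharge.Build _ _ _ (mseries m 0) (measure0 _) fin
  (@measure_semi_sigma_additive _ _ _ (mseries m 0)).
pose nu : {charge set T -> \bar R} := HB.pack (mseries m 0) C.
by exists nu.
Qed.

Variable mu : nat -> {charge set T -> \bar R}.
Let nu k := csub (mu k.+1) (mu k).
Hypothesis summable : \sum_(0 <= k <oo) wnorm W (nu k) < +oo.

Let posm k : {measure set T -> \bar R} := jordan_pos (hahn_spec (nu k)).
Let negm k : {measure set T -> \bar R} := jordan_neg (hahn_spec (nu k)).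
Let varm k : {measure set T -> \bar R} := charge_variation (hahn_spec (nu k)).

Let varmE n A : mseries varm n A = mseries posm n A + mseries negm n A.
Proof. by rewrite /mseries -nneseriesD. Qed.

Let varm_int n :
  \int[mseries varm n]_x (W x)%:E <= \sum_(n <= k <oo) wnorm W (nu k).
Proof.
(* The tail is reindexed from 0 so that the exchange of integral and series of measures applies. *)
have -> : \sum_(n <= k <oo) wnorm W (nu k) =
          \sum_(k <oo) \int[varm (k + n)%N]_x (W x)%:E.
  have w0 k : 0 <= wnorm W (nu k) by exact: wnorm_ge0.
  exact: esym (@nneseries_addn _ (fun k => wnorm W (nu k)) n w0).
have mEW : measurable_fun setT (fun x => (W x)%:E) by exact/measurable_EFinP.
have W0' x : setT x -> 0 <= (W x)%:E by rewrite lee_fin.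
rewrite -(ge0_integral_measure_series (fun k => varm (k + n)%N) measurableT W0' mEW).
apply: ge0_le_measure_integral; [|exact: measurableT|by move=> x; exact: W0'|exact: mEW].
move=> A mA.
have := @nneseries_addn _ (fun k => varm k A) n (fun k => measure_ge0 (varm k) A).
by move=> E; rewrite le_eqVlt; apply/orP; left; apply/eqP; exact: esym E.
Qed.

(** The positive and negative parts of the increments are summed separately into finite measures [p]
    and [q], and [mu 0 + p - q] is the limit. The tail of the series of variations dominates its
    distance to [mu n], which gives an explicit rate. *)
Lemma charge_complete : exists s : {charge set T -> \bar R},
  forall n, wnorm W (csub s (mu n)) <= \sum_(n <= k <oo) wnorm W (nu k).
Proof.
(* As [W >= 1], the total mass is at most the weighted integral. *)
have voo : mseries varm 0 setT < +oo.
  apply: le_lt_trans summable; apply: le_trans (varm_int 0).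
  rewrite -[leLHS]mul1e -integral_cst//; apply: ge0_le_integral => //=.
  - exact/measurable_EFinP.
  - by move=> x _; rewrite lee_fin.
have [p pE] : exists p : {charge set T -> \bar R}, forall A, p A = mseries posm 0 A.
  apply: mseries_charge; apply: le_lt_trans voo.
  by rewrite varmE leeDl// measure_ge0.
have [q qE] : exists q : {charge set T -> \bar R}, forall A, q A = mseries negm 0 A.
  apply: mseries_charge; apply: le_lt_trans voo.
  by rewrite varmE leeDr// measure_ge0.
exists (clin 1 1 (mu 0%N) (csub p q)) => n.
apply: le_trans (varm_int n); apply: wnorm_le_integral => // A mA.
have pn := mseries_split posm n A; have qn := mseries_split negm n A.
(* The first [n] increments telescope, so only the tails of [p] and [q] survive in [s - mu n]. *)
have tele : \sum_(0 <= k < n) posm k A - \sum_(0 <= k < n) negm k A = mu n A - mu 0%N A.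
  have finp k : posm k A \is a fin_num by rewrite fin_num_measure.
  have finn k : negm k A \is a fin_num by rewrite fin_num_measure.
  elim: n {pn qn} => [|n IH]; first by rewrite !big_geq// !subee ?fin_num_measure.
  rewrite !big_nat_recr// fin_num_oppeD//.
  rewrite addeACA IH.
  have -> : posm n A - negm n A = mu n.+1 A - mu n A.
    by have := ceq_jordan (nu n) mA; rewrite {1}/nu !csubE => E; exact: esym E.
  rewrite addeC addeA subeK// fin_num_measure//.
rewrite csubE clinE !mul1e csubE pE qE [leRHS]varmE.
have : p A \is a fin_num by rewrite fin_num_measure.
have : q A \is a fin_num by rewrite fin_num_measure.
rewrite pE qE pn qn !fin_numD => /andP[fq fqn] /andP[fp fpn].
have -> : mu 0%N A + (\sum_(0 <= k < n) posm k A + mseries posm n A -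
    (\sum_(0 <= k < n) negm k A + mseries negm n A)) - mu n A =
    mseries posm n A - mseries negm n A.
  rewrite fin_num_oppeD// [X in _ + X - _]addeACA tele.
  have f0 : mu 0%N A \is a fin_num by rewrite fin_num_measure.
  have fn : mu n A \is a fin_num by rewrite fin_num_measure.
  rewrite -(fineK f0) -(fineK fn) -(fineK fpn) -(fineK fqn).
  by rewrite -!EFinB; congr EFin; ring.
by rewrite (le_trans (lee_abs_sub _ _))// !gee0_abs ?measure_ge0.
Qed.

End completeness.

(* [n] and [w] stand for the total variation and weighted norms of a measure, [n'] and [w'] for those of its image. *)
Lemma contraction_factor (R : realType) (e c A g : R) :
  0 < e < 1 -> 0 < c < A -> 0 < g < 1 ->
  exists beta kappa : R, [/\ 0 < beta, 0 < kappa < 1 &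
    forall n w n' w' : R, 0 <= n -> 0 <= w -> n' <= n ->
      w' <= e * w + c * (1 - e) * n -> (w <= A * n -> n' <= g * n) ->
      n' + beta * w' <= kappa * (n + beta * w)].
Proof.
move=> /andP[e0 e1] /andP[c0 cA] /andP[g0 g1].
pose K := c * (1 - e).
have K0 : 0 < K by rewrite mulr_gt0// subr_gt0.
(* Makes [beta * K] half of the gap [1 - g]: the Lyapunov remainder then raises the factor [g] only
   to [(1 + g) / 2]. *)
pose beta := (1 - g) / (2 * K).
have beta0 : 0 < beta by rewrite divr_gt0 ?subr_gt0// mulr_gt0.
have bK : beta * K = (1 - g) / 2 by rewrite /beta; field; rewrite gt_eqF.
have A0 : 0 < A by exact: lt_trans cA.
have D0 : 0 < 1 + beta * A by rewrite ltr_wpDl// mulr_gt0.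
(* The ratio of the bound on the new norm to the old norm at the boundary [w = A * n], the worst
   case when [w > A * n]. It is below 1 because [c < A] gives [K + A * e < A]. *)
pose q := (1 + beta * (K + A * e)) / (1 + beta * A).
pose kappa := Num.max ((1 + g) / 2) (Num.max e q).
have KA : K + A * e < A.
  have : 0 < (A - c) * (1 - e) by rewrite mulr_gt0// subr_gt0.
  by rewrite /K; lra.
have q1 : q < 1.
  by rewrite /q ltr_pdivrMr// mul1r ltrD2l ltr_pM2l.
have qE : q * (1 + beta * A) = 1 + beta * (K + A * e).
  by rewrite /q mulfVK// gt_eqF.
have kg : (1 + g) / 2 <= kappa by rewrite /kappa le_max lexx.
have ke : e <= kappa by rewrite /kappa !le_max lexx orbT.
have kq : q <= kappa by rewrite /kappa !le_max lexx !orbT.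
have k1 : kappa < 1 by rewrite /kappa !gt_max e1 q1 !andbT; lra.
clearbody kappa q beta.
exists beta, kappa; split => //; first by rewrite k1 andbT; lra.
move=> n w n' w' n0 w0 nn ww Ag.
have bw : beta * w' <= beta * (e * w) + beta * K * n.
  by rewrite -mulrA -mulrDr ler_pM2l.
have ew : beta * (e * w) <= kappa * (beta * w).
  by rewrite mulrCA ler_wpM2r// mulr_ge0// ltW.
have [wA|wA] := leP w (A * n).
  have gn : (1 + g) / 2 * n <= kappa * n by rewrite ler_wpM2r.
  have g' := Ag wA; rewrite bK in bw. lra.
(* Here [n] itself need not shrink: the surplus [kappa - e] in the weighted term, with [w > A * n],
   pays for the coefficient of [n]. *)
have h1 : beta * (kappa - e) * (A * n) <= beta * (kappa - e) * w.
  by rewrite ler_wpM2l ?mulr_ge0 ?subr_ge0// ltW.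
have h2 : (1 + beta * (K + A * e)) * n <= kappa * (1 + beta * A) * n.
  by rewrite ler_wpM2r// -qE ler_pM2r.
lra.
Qed.

(** * Exponential decay on measures of mass zero *)

Section semigroup.
Context (d : measure_display) (T : measurableType d) (R : realType).
Implicit Types mu nu : {charge set T -> \bar R}.
Variables (V : T -> R)
  (S : R -> {charge set T -> \bar R} -> {charge set T -> \bar R}).
Hypotheses (mV : measurable_fun setT V) (V1 : forall x, 1 <= V x).
Hypothesis hS : stochastic_semigroup S.
Hypothesis stab : forall t mu, 0 <= t -> inMW V mu -> inMW V (S t mu).

Let V0 x : 0 <= V x. Proof. exact: le_trans (V1 x). Qed.

Let stoS t : 0 <= t -> stochastic_operator (S t).
Proof. by have [h _ _] := hS; exact: h. Qed.

Let wfin mu : inMW V mu -> wnorm V mu \is a fin_num.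
Proof. by move=> h; rewrite ge0_fin_numE// wnorm_ge0. Qed.

Let x mu := fine (tvnorm mu).
(** Since [fine] sends infinity to 0, [y] represents the norm only under [inMW V], hence the
    membership hypotheses carried along below. *)
Let y mu := fine (wnorm V mu).

Let x0 mu : 0 <= x mu. Proof. by rewrite fine_ge0// tvnorm_ge0. Qed.
Let y0 mu : 0 <= y mu. Proof. by rewrite fine_ge0// wnorm_ge0. Qed.
Let xE mu : tvnorm mu = (x mu)%:E. Proof. by rewrite fineK// tvnorm_fin. Qed.
Let yE mu : inMW V mu -> wnorm V mu = (y mu)%:E.
Proof. by move=> h; rewrite fineK// wfin. Qed.
Let xy mu : inMW V mu -> x mu <= y mu.
Proof. by move=> h; rewrite -lee_fin -xE -yE// tvnorm_le_wnorm. Qed.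

Let inN_S t nu : 0 <= t -> inN nu -> inN (S t nu).
Proof. by move=> t0 h; rewrite /inN (stochastic_mass (stoS t0)). Qed.

Section decay.
Variables (sigma b Tt g A : R).
Hypotheses (sigma0 : 0 < sigma) (b0 : 0 < b) (T0 : 0 < Tt) (g01 : 0 < g < 1).
Hypotheses (A0 : 0 < A) (bA : b / A < sigma).
Hypothesis lyapunov : forall t mu, 0 <= t -> inMW V mu ->
  (wnorm V (S t mu) <= (expR (- sigma * t))%:E * wnorm V mu
     + (b / sigma * (1 - expR (- sigma * t)))%:E * tvnorm mu)%E.
Hypothesis harris : forall nu, inN nu -> inMW V nu ->
  (wnorm V nu <= A%:E * tvnorm nu)%E ->
  (tvnorm (S Tt nu) <= g%:E * tvnorm nu)%E.

Let lyapR t mu : 0 <= t -> inMW V mu ->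
  y (S t mu) <= expR (- sigma * t) * y mu
     + b / sigma * (1 - expR (- sigma * t)) * x mu.
Proof.
move=> t0 h; have := lyapunov t0 h.
by rewrite !yE// ?xE -?EFinM -?EFinD ?lee_fin//; exact: stab.
Qed.

(** A bound uniform in [t], from [x mu <= y mu] and an exponential at most 1; it controls the time
    left over between multiples of [Tt]. *)
Let lyap_bound t mu : 0 <= t -> inMW V mu ->
  y (S t mu) <= (1 + b / sigma) * y mu.
Proof.
move=> t0 h; apply: le_trans (lyapR t0 h) _.
have e1 : expR (- sigma * t) <= 1.
  by rewrite -expR0 ler_expR mulNr oppr_le0 mulr_ge0// ltW.
rewrite mulrDl; apply: lerD; first by rewrite ler_wpM2r.
have bs : 0 <= b / sigma by rewrite divr_ge0// ltW.
rewrite -mulrA ler_wpM2l// -[leRHS]mul1r ler_pM ?subr_ge0 ?xy//.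
Qed.

Let step : exists beta kappa : R, [/\ 0 < beta, 0 < kappa < 1 &
  forall nu, inN nu -> inMW V nu ->
  x (S Tt nu) + beta * y (S Tt nu) <= kappa * (x nu + beta * y nu)].
Proof.
have [||//|beta [kappa [beta0 k01 H]]] :=
    @contraction_factor R (expR (- sigma * Tt)) (b / sigma) A g.
- by rewrite expR_gt0 -expR0 ltr_expR mulNr oppr_lt0 mulr_gt0.
- rewrite divr_gt0//= ltr_pdivrMr// mulrC; move: bA; rewrite ltr_pdivrMr//.
exists beta, kappa; split => // nu hN hV; apply: H => //.
- by rewrite -lee_fin -!xE tvnorm_stochastic//; exact/stoS/ltW.
- by apply: lyapR => //; exact: ltW.
- move=> wA; have := harris hN hV; rewrite yE// !xE -!EFinM !lee_fin; exact.
Qed.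

Lemma harris_decay : exists lambda C : R, 0 < lambda /\ 0 < C /\
  forall t nu, 0 <= t -> inN nu -> inMW V nu ->
    (wnorm V (S t nu) <= (C * expR (- lambda * t))%:E * wnorm V nu)%E.
Proof.
have [beta [kappa [beta0 /andP[k0 k1] H]]] := step.
have [_ S0 SD] := hS.
have iterk k nu : inN nu -> inMW V nu ->
    x (S (k%:R * Tt) nu) + beta * y (S (k%:R * Tt) nu)
    <= kappa ^+ k * (x nu + beta * y nu).
  move=> hN hV; elim: k => [|k IH].
    rewrite mul0r expr0 mul1r /x /y (tvnorm_ceq (S0 nu)).
    by rewrite (wnorm_ceq mV V0 (S0 nu)).
  have kT : 0 <= k%:R * Tt by rewrite mulr_ge0// ltW.
  have E : ceq (S (k.+1%:R * Tt) nu) (S Tt (S (k%:R * Tt) nu)).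
    by rewrite -natr1 mulrDl mul1r addrC; apply: SD => //; exact: ltW.
  rewrite {1}/x {1}/y (tvnorm_ceq E) (wnorm_ceq mV V0 E).
  apply: le_trans (H _ (inN_S kT hN) (stab kT hV)) _.
  by rewrite exprS -mulrA ler_pM2l.
(* The rate for which [expR (- lambda * Tt) = kappa]. *)
pose lambda := - ln kappa / Tt.
have lambda0 : 0 < lambda by rewrite divr_gt0// oppr_gt0 ln_lt0// k0 k1.
pose c := 1 + b / sigma.
have c0 : 0 < c by rewrite /c addr_gt0// divr_gt0.
(* Three losses: [c] for the leftover time, [(1 + beta) / beta] for passing between the mixed norm
   and the weighted norm, and [kappa^-1] for rounding [t / Tt] down. *)
pose C := c * ((1 + beta) / beta) / kappa.
have C0 : 0 < C.
  by rewrite /C !(divr_gt0, mulr_gt0)// addr_gt0.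
exists lambda, C; split => //; split => // t nu t0 hN hV.
rewrite !yE//; last exact: stab.
rewrite -EFinM lee_fin.
pose k := Num.truncn (t / Tt).
have tT : 0 <= t / Tt by rewrite divr_ge0// ltW.
have /andP[kt tk] := truncn_itv tT.
have kT : 0 <= k%:R * Tt by rewrite mulr_ge0// ltW.
have r0 : 0 <= t - k%:R * Tt by rewrite subr_ge0 -ler_pdivlMr.
have E : ceq (S t nu) (S (t - k%:R * Tt) (S (k%:R * Tt) nu)).
  by rewrite -{1}(subrK (k%:R * Tt) t); apply: SD.
rewrite {1}/y (wnorm_ceq mV V0 E) -/(y _).
apply: le_trans (lyap_bound r0 (stab kT hV)) _.
have yk : y (S (k%:R * Tt) nu) <= (1 + beta) / beta * (kappa ^+ k * y nu).
  have h := iterk k nu hN hV.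
  have hb : beta * y (S (k%:R * Tt) nu) <= (1 + beta) * (kappa ^+ k * y nu).
    apply: (@le_trans _ _ (kappa ^+ k * (x nu + beta * y nu))).
      by apply: le_trans h; rewrite lerDr.
    by rewrite mulrCA ler_pM2l ?exprn_gt0// mulrDl mul1r lerD2r xy.
  by rewrite mulrAC ler_pdivlMr// mulrC.
(* Equivalently [kappa ^+ k.+1 <= expR (- lambda * t)], which holds as [t / Tt < k.+1] and
   [ln kappa] is negative. *)
have kk : kappa ^+ k <= kappa^-1 * expR (- lambda * t).
  rewrite mulrC ler_pdivlMr// -exprSr -[kappa in leLHS]lnK ?posrE//.
  rewrite -expRM_natl ler_expR.
  have -> : - lambda * t = (t / Tt) * ln kappa by rewrite /lambda; field; rewrite gt_eqF.
  by apply: ler_wnM2r; [rewrite ln_le0// ltW|exact: ltW].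
rewrite -/c; apply: le_trans (_ : c * ((1 + beta) / beta * (kappa^-1 * expR (- lambda * t) * y nu)) <= _).
  rewrite ler_pM2l//; apply: le_trans yk _.
  rewrite ler_pM2l ?divr_gt0 ?addr_gt0// ler_wpM2r//.
by rewrite /C le_eqVlt; apply/orP; left; apply/eqP; field; rewrite !gt_eqF.
Qed.

End decay.
End semigroup.

(** * Geometric series and limits in the extended reals *)

Lemma nneseries_geometric_lt_pinfty (R : realType) (a q : R) (u : (\bar R)^nat) :
  0 <= q < 1 -> (forall n, 0 <= u n)%E -> (forall n, u n <= (a * q ^+ n)%:E)%E ->
  (\sum_(0 <= n <oo) u n < +oo)%E.
Proof.
move=> /andP[q0 q1] u0 ua.
have a0 : 0 <= a.
  by have := le_trans (u0 0%N) (ua 0%N); rewrite lee_fin expr0 mulr1.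
have nq : `|q| < 1 by rewrite ger0_norm.
have sub1q : 0 < 1 - q by rewrite subr_gt0.
apply: (@le_lt_trans _ _ (a / (1 - q))%:E); last exact: ltry.
apply: lime_le; first exact: is_cvg_ereal_nneg_natsum.
apply: nearW => n.
apply: (@le_trans _ _ (\sum_(0 <= k < n) (a * q ^+ k)%:E)%E).
  by apply: lee_sum => k _.
rewrite sumEFin lee_fin.
have := @geometric_seriesE R a q; rewrite lt_eqF// => /(_ isT) /(congr1 (@^~ n)).
rewrite /series/= => ->.
rewrite mulrBr mulr1 ler_pM2r ?invr_gt0// gerBl mulr_ge0// exprn_ge0//.
Qed.

Lemma le_cvg0 (R : realType) (z : \bar R) (u : (\bar R)^nat) :
  u n @[n --> \oo] --> 0%E -> (forall n, z <= u n)%E -> (z <= 0)%E.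
Proof.
move=> u0 zu; rewrite -(cvg_lim _ u0)//; apply: lime_ge; last exact: nearW.
by apply/cvg_ex; exists 0%E.
Qed.

(** * Existence and uniqueness of the invariant probability measure *)

Section invariant_measure.
Context (d : measure_display) (T : measurableType d) (R : realType).
Implicit Types mu nu : {charge set T -> \bar R}.
Variables (V : T -> R)
  (S : R -> {charge set T -> \bar R} -> {charge set T -> \bar R}).
Hypotheses (mV : measurable_fun setT V) (V1 : forall x, 1 <= V x).
Hypothesis hS : stochastic_semigroup S.
Hypothesis stab : forall t mu, 0 <= t -> inMW V mu -> inMW V (S t mu).
Variables (lambda C : R).
Hypothesis lambda0 : 0 < lambda.
Hypothesis decay : forall t nu, 0 <= t -> inN nu -> inMW V nu ->
  (wnorm V (S t nu) <= (C * expR (- lambda * t))%:E * wnorm V nu)%E.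

Let V0 x : 0 <= V x. Proof. exact: le_trans (V1 x). Qed.

Let stoS t : 0 <= t -> stochastic_operator (S t).
Proof. by have [h _ _] := hS; exact: h. Qed.

Lemma inMW_csub mu nu : inMW V mu -> inMW V nu -> inMW V (csub mu nu).
Proof.
by move=> h1 h2; apply: le_lt_trans (wnorm_csub mV V0 _ _) _; rewrite lte_add_pinfty.
Qed.

Lemma inN_csub mu nu : mu setT = nu setT -> inN (csub mu nu).
Proof. by move=> e; rewrite /inN csubE e subee// fin_num_measure. Qed.

Lemma inMW_cdirac : inMW V (cdirac T R).
Proof.
have mEV : measurable_fun setT (fun x => (V x)%:E) by exact/measurable_EFinP.
apply: (@le_lt_trans _ _ (\int[\d_(point : T)]_x (V x)%:E)%E).
  by apply: wnorm_le_integral => // A mA; rewrite gee0_abs// measure_ge0.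
by rewrite integral_dirac// diracT mul1e ltry.
Qed.

Let q := expR (- lambda).

Let q01 : 0 < q < 1.
Proof. by rewrite expR_gt0 -expR0 ltr_expR oppr_lt0. Qed.

Let geometric_decay nu : inN nu -> inMW V nu ->
  exists M : R, forall n, (wnorm V (S n%:R nu) <= (M * q ^+ n)%:E)%E.
Proof.
move=> hN hV; exists (C * fine (wnorm V nu)) => n.
apply: le_trans (decay _ hN hV) _; first exact: ler0n.
rewrite -(@fineK _ (wnorm V nu)); last by rewrite ge0_fin_numE// wnorm_ge0.
by rewrite -EFinM lee_fin expRM_natr mulrAC.
Qed.

Let tv_cvg0 nu : inN nu -> inMW V nu ->
  tvnorm (S n%:R nu) @[n --> \oo] --> 0%E.
Proof.
move=> hN hV; have [M HM] := geometric_decay hN hV.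
have /andP[q0 q1] := q01.
apply: (@squeeze_cvge _ _ _ _ (cst 0%E) _ (fun n => (M * q ^+ n)%:E)).
- by apply: nearW => n; rewrite tvnorm_ge0/= (le_trans _ (HM n))// tvnorm_le_wnorm.
- exact: cvg_cst.
- apply/fine_cvgP; split; first exact: nearW.
  by apply: cvg_geometric; rewrite ger0_norm// ltW.
Qed.

(** With [mu] and [nu] both the Dirac mass, this turns differences along the orbit into images of
    one fixed charge of mass zero, to which the decay applies. *)
Let semigroup_csub mu nu t s : 0 <= s -> 0 <= t ->
  ceq (csub (S (t + s) mu) (S t nu)) (S t (csub (S s mu) nu)).
Proof.
move=> s0 t0 A mA; have [_ _ SD] := hS.
by rewrite (stochastic_csub (stoS t0))// !csubE SD.
Qed.

(** The difference has mass zero and is fixed by the semigroup, while its images tend to 0. *)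
Lemma invariant_unique mu nu : inP mu -> inP nu -> inMW V mu -> inMW V nu ->
  (forall t, 0 <= t -> ceq (S t mu) mu) ->
  (forall t, 0 <= t -> ceq (S t nu) nu) -> ceq mu nu.
Proof.
move=> [_ mu1] [_ nu1] hmu hnu imu inu.
have hN : inN (csub mu nu) by apply: inN_csub; rewrite mu1.
apply: ceq_tvnorm_csub.
apply: le_cvg0 (tv_cvg0 hN (inMW_csub hmu hnu)) _ => n.
rewrite le_eqVlt; apply/orP; left; apply/eqP/tvnorm_ceq => A mA.
by rewrite (stochastic_csub (stoS (ler0n _ n)))// !csubE imu ?inu.
Qed.

(** The orbit of the Dirac mass at integer times has geometrically small increments, so
    [charge_complete] yields a limit. Nonnegativity and mass 1 pass to it by setwise convergence. *)
Lemma invariant_exists : exists mu : {charge set T -> \bar R},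
  [/\ inP mu, inMW V mu & forall t, 0 <= t -> ceq (S t mu) mu].
Proof.
have [_ S0 SD] := hS; have [d0 d1] := inP_cdirac T R.
pose delta := cdirac T R; pose mu n := S n%:R delta.
have SN t : 0 <= t -> inN (csub (S t delta) delta).
  by move=> t0; apply: inN_csub; rewrite (stochastic_mass (stoS t0)).
have SV t : 0 <= t -> inMW V (csub (S t delta) delta).
  by move=> t0; apply: inMW_csub; [apply: stab => //|]; exact: inMW_cdirac.
have w0 n : (0 <= wnorm V (csub (mu n.+1) (mu n)))%E by exact: wnorm_ge0.
have foo : (\sum_(0 <= n <oo) wnorm V (csub (mu n.+1) (mu n)) < +oo)%E.
  have [M HM] := geometric_decay (SN 1 ler01) (SV 1 ler01).
  have /andP[q0 q1] := q01.
  apply: (@nneseries_geometric_lt_pinfty R M q) => //; first by rewrite ltW.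
  move=> n; apply: le_trans (HM n).
  rewrite le_eqVlt; apply/orP; left; apply/eqP/wnorm_ceq => //.
  by rewrite /mu -natr1; apply: semigroup_csub.
have [s Hs] := charge_complete mV V1 foo.
have dist0 : tvnorm (csub s (mu n)) @[n --> \oo] --> 0%E.
  apply: (@squeeze_cvge _ _ _ _ (cst 0%E) _
      (fun n => (\sum_(n <= k <oo) wnorm V (csub (mu k.+1) (mu k)))%E)).
  - apply: nearW => n; rewrite tvnorm_ge0/= (le_trans _ (Hs n))//.
    exact: tvnorm_le_wnorm.
  - exact: cvg_cst.
  - exact: nneseries_tail_cvg.
have muP n : inP (mu n).
  by have [_ h] := stoS (ler0n R n); apply: h; exact: inP_cdirac.
have close A n : measurable A -> (`|s A - mu n A| <= tvnorm (csub s (mu n)))%E.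
  by move=> mA; rewrite -csubE abse_le_tvnorm.
exists s; split.
- split => [A mA|].
    rewrite -oppe_le0; apply: le_cvg0 dist0 _ => n.
    apply: le_trans (close A n mA); rewrite -abseN; apply: le_trans (lee_abs _).
    have [h _] := muP n.
    by rewrite fin_num_oppeB ?fin_num_measure// leeDl// h.
  have : (s setT - 1 = 0)%E.
    apply/eqP; rewrite -abse_eq0 eq_le abse_ge0 andbT.
    apply: le_cvg0 dist0 _ => n; apply: le_trans (close setT n measurableT).
    by have [_ ->] := muP n.
  by move=> e; rewrite -(@subeK _ (s setT) 1)// e add0e.
(* The rate at [n = 0] bounds the distance from [s] to the start of the orbit by the whole finite
   sum. *)
- apply: le_lt_trans (wnorm_triangle mV V0 s (mu 0%N)) _.
  apply: lte_add_pinfty; first exact: le_lt_trans (Hs 0%N) foo.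
  by apply: stab => //; exact: inMW_cdirac.
move=> t t0.
apply: ceq_tvnorm_csub.
(* Path from [S t s] to [s] through [S t (mu n)] and [mu n]: nonexpansiveness handles the first leg,
   and commuting [S t] with [S n%:R] makes the second the decay of [S t delta - delta]. Thus integer
   times give invariance at every real [t]. *)
pose u n := (tvnorm (csub s (mu n)) + (tvnorm (S n%:R (csub (S t delta) delta))
   + tvnorm (csub s (mu n))))%E.
have u0 : u n @[n --> \oo] --> 0%E.
  rewrite -[X in _ --> X](adde0 0%E) -[X in _ --> (_ + X)%E](adde0 0%E).
  by apply: cvgeD => //; apply: cvgeD => //; exact: tv_cvg0 (SN t t0) (SV t t0).
apply: le_cvg0 u0 _ => n; rewrite /u.
apply: le_trans (tvnorm_csub_triangle _ (S t (mu n)) _) _; apply: leeD.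
  rewrite -(tvnorm_ceq (stochastic_csub (stoS t0) s (mu n))).
  exact: tvnorm_stochastic (stoS t0) _.
apply: le_trans (tvnorm_csub_triangle _ (mu n) _) _; apply: leeD.
  rewrite le_eqVlt; apply/orP; left; apply/eqP/tvnorm_ceq => A mA.
  rewrite -(semigroup_csub _ _ t0 (ler0n R n) mA) !csubE; congr (_ - _)%E.
  by rewrite /mu -SD// addrC.
by rewrite tvnorm_csubC.
Qed.

End invariant_measure.

Theorem theorem5p2 (d : measure_display) (T : measurableType d) (R : realType)
  (V : T -> R)
  (S : R -> {charge set T -> \bar R} -> {charge set T -> \bar R}) :
  measurable_fun [set: T] V ->
  (forall x, 1 <= V x) ->
  stochastic_semigroup_on V S ->
  (exists sigma b : R, 0 < sigma /\ 0 < b /\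
     (forall t mu, 0 <= t -> inMW V mu ->
        (wnorm V (S t mu) <= (expR (- sigma * t))%:E * wnorm V mu
           + (b / sigma * (1 - expR (- sigma * t)))%:E * tvnorm mu)%E) /\
     (exists Tt gammaH A : R, 0 < Tt /\ 0 < gammaH < 1 /\ 0 < A /\ b / A < sigma /\
        forall nu, inN nu -> inMW V nu ->
          (wnorm V nu <= A%:E * tvnorm nu)%E ->
          (tvnorm (S Tt nu) <= gammaH%:E * tvnorm nu)%E)) ->
  (exists mustar : {charge set T -> \bar R},
     [/\ inP mustar, inMW V mustar,
         (forall t, 0 <= t -> ceq (S t mustar) mustar) &
         (forall mu, inP mu -> inMW V mu ->
            (forall t, 0 <= t -> ceq (S t mu) mu) -> ceq mu mustar)])
  /\ (exists lambda C : R, 0 < lambda /\ 0 < C /\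
        forall t nu, 0 <= t -> inN nu -> inMW V nu ->
          (wnorm V (S t nu) <= (C * expR (- lambda * t))%:E * wnorm V nu)%E).
Proof.
move=> mV V1 [hS stab _].
move=> [sigma [b [sigma0 [b0 [lyap [Tt [g [A [T0 [g01 [A0 [bA harris]]]]]]]]]]]].
have decay := harris_decay mV V1 hS stab sigma0 b0 T0 g01 A0 bA lyap harris.
split; last exact: decay.
have [lambda [C [lambda0 [C0 H]]]] := decay.
have [mustar [muP muV inv]] := invariant_exists mV V1 hS stab lambda0 H.
exists mustar; split => // mu hP hV hinv.
exact: (invariant_unique mV V1 hS lambda0 H) hP muP hV muV hinv inv.
Qed.
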